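(* Let $\theta(x)=-\log(f(x))$, where $f(x)=p(x)-q(x)$ is a dc function on a convex set $\mathcal{D}\subseteq\mathbb{R}^n$ (with $p$ and $q$ convex on $\mathcal{D}$) such that $\inf_{x\in\mathcal{D}}f(x)>0$. Then there exists a scalar $M>0$ such that the function $\theta(x)+M\,p(x)$ is convex on $\mathcal{D}$; thus $\theta$ has the dc decomposition $\theta(x)=[\theta(x)+M\,p(x)]-M\,p(x)$ on $\mathcal{D}$.
   Context: A function on a convex set is dc (difference-of-convex) if it is the difference of two real-valued convex functions on that set; such an expression is a dc decomposition. *)

(* Defs.v *)
From mathcomp Require Import all_boot all_order all_algebra.
From mathcomp Require Import all_classical all_reals all_analysis.

Set Implicit Arguments.
Unset Strict Implicit.
Unset Printing Implicit Defensive.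

Import Order.TTheory GRing.Theory Num.Theory.

Local Open Scope classical_set_scope.
Local Open Scope ring_scope.

(* Functions are total on the ambient space; only their values on D matter. *)
Definition dc_decomposition (R : realType) (E : lmodType R) (D : set E)
    (f g h : E -> R) : Prop :=
  [/\ convex_function D g, convex_function D h
    & forall x, D x -> f x = g x - h x].

(* Main.v *)
(* If f >= m > 0 on D, then M = 1/m works.  Since ln is concave with slope at
   most 1/m on [m, +oo[, the convexity gap of -ln f is bounded below by -1/m
   times the positive part of the concavity defect of f; as f = p - q with q
   convex, that defect is at most the convexity gap of p. *)
Require Import Defs.
From mathcomp Require Import all_boot all_order all_algebra.
From mathcomp Require Import all_classical all_reals all_analysis.
From mathcomp Require Import lra.

Set Implicit Arguments.
Unset Strict Implicit.
Unset Printing Implicit Defensive.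

Import Order.TTheory GRing.Theory Num.Theory.

Local Open Scope classical_set_scope.
Local Open Scope ring_scope.

(** The graph of [ln] lies below its tangent at [b]: this is [ln (1 + u) <= u] with
    [u = (a - b) / b]. *)
Lemma ler_ln_sub (R : realType) (a b : R) :
  0 < a -> 0 < b -> ln a - ln b <= (a - b) / b.
Proof.
move=> a0 b0; rewrite -ln_div ?posrE//.
have -> : a / b = 1 + (a - b) / b by rewrite mulrBl divff ?gt_eqF// addrC subrK.
by apply: le_ln1Dx; rewrite mulrBl divff ?gt_eqF// ltrBDr addrC subrr divr_gt0.
Qed.

Lemma ereal_inf_gt0_lbound (R : realType) (T : Type) (D : set T) (f : T -> R) :
  (0 < ereal_inf [set (f x)%:E | x in D])%E ->
  exists2 m : R, 0 < m & forall x, D x -> m <= f x.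
Proof.
move=> inf_gt0.
have inf_le x : D x -> (ereal_inf [set (f x)%:E | x in D] <= (f x)%:E)%E.
  by move=> Dx; apply: ereal_inf_lbound; exists x.
case: (ereal_inf _) inf_gt0 inf_le => [r| |] //.
  by rewrite lte_fin => r0 rf; exists r => // x /rf; rewrite lee_fin.
(* An infimum of [+oo] over real values forces [D] to be empty, so the bound [1] is arbitrary. *)
by move=> _ inf_le; exists 1 => // x /inf_le; rewrite leye_eq.
Qed.

Lemma convex_function_scale (R : realType) (E : lmodType R) (D : set E)
    (g : E -> R) (c : R) :
  0 <= c -> convex_function D g -> convex_function D (fun x => c * g x).
Proof.
move=> c0 g_convex t x y xD yD.
have := ler_wpM2l c0 (g_convex t x y xD yD).
by rewrite !convRE mulrDr !(mulrCA c).
Qed.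

Lemma convex_function_lnN_add (R : realType) (E : lmodType R) (D : set E)
    (f p q : E -> R) (m : R) :
  convex_set D -> dc_decomposition D f p q ->
  0 < m -> (forall x, D x -> m <= f x) ->
  convex_function D (fun x => - ln (f x) + m^-1 * p x).
Proof.
move=> D_convex [p_convex q_convex fE] m0 mf t x y xD yD.
have zD := D_convex x y t xD yD.
set z := conv t x y in zD *.
have p_le : p z <= t%:num * p x + (1 - t%:num) * p y := p_convex t x y xD yD.
have q_le : q z <= t%:num * q x + (1 - t%:num) * q y := q_convex t x y xD yD.
move: xD yD zD; rewrite !inE => Dx Dy Dz.
have f_gt0 u : D u -> 0 < f u by move=> /mf; exact: lt_le_trans.
set v := t%:num * f x + (1 - t%:num) * f y.
have v_gt0 : 0 < v := convR_gt0 t (f_gt0 _ Dx) (f_gt0 _ Dy).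
have ln_conv : t%:num * ln (f x) + (1 - t%:num) * ln (f y) <= ln v :=
  concave_ln t (f_gt0 _ Dx) (f_gt0 _ Dy).
have ln_diff := ler_ln_sub v_gt0 (f_gt0 _ Dz).
have diff_le : (v - f z) / f z
    <= (t%:num * p x + (1 - t%:num) * p y - p z) * m^-1.
  (* The order of the two bounds matters: [v - f z] may be negative, so [f z] cannot yet be replaced
     by [m]. Convexity of [q] first bounds it by the convexity gap of [p], which is nonnegative;
     only then does [m <= f z] apply. *)
  apply: (@le_trans _ _ ((t%:num * p x + (1 - t%:num) * p y - p z) / f z)).
    rewrite ler_pM2r ?invr_gt0 ?f_gt0//.
    by rewrite /v (fE x)// (fE y)// (fE z)//; lra.
  apply: ler_wpM2l; first by rewrite subr_ge0.
  by rewrite lef_pV2 ?posrE ?f_gt0// mf.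
(* Unfolding the convex combinations by conversion leaves a linear consequence of [ln_conv],
   [ln_diff] and [diff_le]. *)
suff goalE : - ln (f z) + m^-1 * p z <= t%:num * (- ln (f x) + m^-1 * p x)
    + (1 - t%:num) * (- ln (f y) + m^-1 * p y) by exact: goalE.
lra.
Qed.

Theorem proposition6 (R : realType) (n : nat) (D : set 'rV[R]_n)
    (f p q theta : 'rV[R]_n -> R)
    (D_convex : convex_set D)
    (f_dc : dc_decomposition D f p q)
    (inf_f_gt0 : (0 < ereal_inf [set (f x)%:E | x in D])%E)
    (thetaE : forall x, D x -> theta x = - ln (f x)) :
  exists M : R,
    [/\ 0 < M,
        convex_function D (fun x => theta x + M * p x)
      & dc_decomposition D theta
          (fun x => theta x + M * p x) (fun x => M * p x)].
Proof.
have [m m0 mf] := ereal_inf_gt0_lbound inf_f_gt0.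
have minv_gt0 : 0 < m^-1 by rewrite invr_gt0.
have sum_convex : convex_function D (fun x => theta x + m^-1 * p x).
  (* [theta] is only known on [D], so convexity is transferred at the three points involved, the
     third lying in [D] by [D_convex]. *)
  move=> t x y xD yD; have zD := D_convex x y t xD yD.
  have := convex_function_lnN_add D_convex f_dc m0 mf t xD yD.
  move: xD yD zD; rewrite !inE => Dx Dy Dz.
  by rewrite (thetaE x Dx) (thetaE y Dy) (thetaE _ Dz).
exists m^-1; split=> //; split=> //; last by move=> x _; rewrite addrK.
by apply: convex_function_scale; [exact: ltW|case: f_dc].
Qed.
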